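(* Let $G$ be a graph with $n$ vertices and $m$ edges having a shortest path with eccentricity $k$. If $G$ has tree-length $\lambda$, a shortest path of $G$ with eccentricity at most $k+2.5\lambda$ can be found in $\mathcal{O}(\lambda m)$ time. If $G$ has hyperbolicity $\delta$, a shortest path of $G$ with eccentricity at most $k+\mathcal{O}(\delta\log n)$ can be found in $\mathcal{O}(\delta m)$ time.
   Context: Graphs are finite, connected, unweighted, undirected and simple; $d_G$ is shortest-path distance, $d_G(v,S)=\min_{u\in S}d_G(u,v)$, $\operatorname{ecc}(S)=\max_{u\in V}d_G(u,S)$. A tree-decomposition of $G=(V,E)$ is a tree $\mathcal{T}$ whose nodes (bags) are subsets of $V$ such that every vertex lies in some bag, every edge has both ends in some bag, and for each vertex the bags containing it induce a subtree of $\mathcal{T}$. $G$ has tree-length $\lambda$ if it has a tree-decomposition in which every bag $B$ satisfies $\max_{u,v\in B}d_G(u,v)\le\lambda$. $G$ has hyperbolicity $\delta$ if for any four vertices $u,v,w,x$, the two larger of the sums $d_G(u,v)+d_G(w,x)$, $d_G(u,w)+d_G(v,x)$, $d_G(u,x)+d_G(v,w)$ differ by at most $2\delta$.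
   Formalization: The time bounds are read as O(max(1, λm)) and O(max(1,δ)·max(1,m)), since the literal bounds are 0 for a one-vertex graph and, in the hyperbolic case, for graphs with δ = 0 such as trees. *)

(* Defs.v *)
From HB Require Import structures.
From mathcomp Require Export all_boot all_order all_algebra.
From mathcomp Require Export reals exp.

Set Implicit Arguments.
Unset Strict Implicit.
Unset Printing Implicit Defensive.

Import Order.TTheory GRing.Theory Num.Theory.

Section Graphs.
Variable T : finType.
Implicit Types (e : rel T) (x y u v w : T) (S : {set T}) (p : seq T).

Definition connected_graph e : Prop :=
  [/\ symmetric e, irreflexive e, (0 < #|T|)%N & forall x y, connect e x y].

(* The least length of an e-walk from x to y; #|T| if there is none. *)
Definition dist e x y : nat :=
  find (fun k => [exists p : k.-tuple T, path e x p && (last x p == y)])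
       (iota 0 #|T|).

(* Distances in a connected graph are < #|T|, so the default value #|T| is
   only reached for S = set0. *)
Definition dist_set e v S : nat := \big[minn/#|T|]_(u in S) dist e u v.

Definition ecc e S : nat := \max_(u : T) dist_set e u S.

(* A path is given by its nonempty sequence of vertices. *)
Definition shortest_path e p : bool :=
  if p is x :: q then path e x q && (size q == dist e x (last x q)) else false.

Definition path_ecc e p : nat := ecc e [set x in p].

Definition is_tree (I : finType) (r : rel I) : Prop :=
  [/\ symmetric r, irreflexive r, (0 < #|I|)%N, forall i j, connect r i j
    & forall c, ucycle r c -> (size c <= 2)%N].

(* In the last clause the bags containing v induce a connected subgraph of the
   tree, i.e. a subtree; it is nonempty by the first clause on vertices. *)
Definition tree_decomposition e (I : finType) (r : rel I) (bag : I -> {set T}) :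
    Prop :=
  [/\ is_tree r,
      forall v, exists i, v \in bag i,
      forall u v, e u v -> exists i, (u \in bag i) && (v \in bag i)
    & forall v i j, v \in bag i -> v \in bag j ->
        connect [rel a b | [&& r a b, v \in bag a & v \in bag b]] i j].

Definition has_tree_length e (lambda : nat) : Prop :=
  exists (I : finType) (r : rel I) (bag : I -> {set T}),
    tree_decomposition e r bag /\
    forall i u v, u \in bag i -> v \in bag i -> (dist e u v <= lambda)%N.

Definition has_hyperbolicity (R : realType) e (delta : R) : Prop :=
  forall u v w x,
    let s := sort geq [:: dist e u v + dist e w x;
                          dist e u w + dist e v x;
                          dist e u x + dist e v w]%N in
    ((nth 0 s 0)%:R - (nth 0 s 1)%:R <= 2 * delta)%R.

End Graphs.

Definition num_edges n (e : rel 'I_n) : nat :=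
  #|[set a : 'I_n * 'I_n | e a.1 a.2 & (a.1 < a.2)%N]|.

(* Model of computation: structured programs for a random access machine with
   registers, indirectly addressed memory, addition and truncated subtraction
   (no multiplication).  Each evaluated operator, each assignment, write and
   test costs one time unit. *)
Inductive expr :=
  | Const of nat
  | Reg of nat
  | Read of expr
  | Add of expr & expr
  | Sub of expr & expr.

Inductive prog :=
  | Skip
  | Assign of nat & expr
  | Write of expr & expr
  | Seq of prog & prog
  | If of expr & prog & prog
  | While of expr & prog.

Record state := State { regs : nat -> nat; mem : nat -> nat }.

Fixpoint eval (s : state) (a : expr) : nat :=
  match a with
  | Const k => k
  | Reg x => regs s x
  | Read b => mem s (eval s b)
  | Add b c => eval s b + eval s c
  | Sub b c => eval s b - eval s c
  end.

Fixpoint cost (a : expr) : nat :=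
  match a with
  | Const _ | Reg _ => 1
  | Read b => (cost b).+1
  | Add b c | Sub b c => (cost b + cost c).+1
  end.

Definition set_reg (s : state) (x v : nat) : state :=
  State [eta regs s with x |-> v] (mem s).

Definition set_mem (s : state) (x v : nat) : state :=
  State (regs s) [eta mem s with x |-> v].

(* exec W P s t s' : P started in s halts in s' after t time units.  W bounds
   the words: assigning or writing a value >= W, or writing at an address >= W, is
   stuck.  Tests succeed on nonzero values. *)
Inductive exec (W : nat) : prog -> state -> nat -> state -> Prop :=
  | ExecSkip s : exec W Skip s 1 s
  | ExecAssign x a s :
      eval s a < W ->
      exec W (Assign x a) s (cost a).+1 (set_reg s x (eval s a))
  | ExecWrite a b s :
      eval s a < W -> eval s b < W ->
      exec W (Write a b) s (cost a + cost b).+1 (set_mem s (eval s a) (eval s b))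
  | ExecSeq P Q s1 s2 s3 t1 t2 :
      exec W P s1 t1 s2 -> exec W Q s2 t2 s3 ->
      exec W (Seq P Q) s1 (t1 + t2) s3
  | ExecIfTrue a P Q s s' t :
      eval s a != 0 -> exec W P s t s' ->
      exec W (If a P Q) s ((cost a).+1 + t) s'
  | ExecIfFalse a P Q s s' t :
      eval s a = 0 -> exec W Q s t s' ->
      exec W (If a P Q) s ((cost a).+1 + t) s'
  | ExecWhileTrue a P s1 s2 s3 t1 t2 :
      eval s1 a != 0 -> exec W P s1 t1 s2 -> exec W (While a P) s2 t2 s3 ->
      exec W (While a P) s1 ((cost a).+1 + t1 + t2) s3
  | ExecWhileFalse a P s :
      eval s a = 0 -> exec W (While a P) s (cost a).+1 s.

(* The adjacency lists may be in any order. *)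
Definition adjacency_lists n (e : rel 'I_n) (adj : 'I_n -> seq 'I_n) : Prop :=
  forall v, uniq (adj v) /\ forall u, (u \in adj v) = e v u.

(* Registers 0 and 1 hold n and m.  The memory starts with n + 1 offsets, the
   i-th being the total length of the lists of the vertices < i, followed by the
   concatenation of the n adjacency lists; all else is 0. *)
Definition input_words n (adj : 'I_n -> seq 'I_n) : seq nat :=
  [seq (\sum_(v < n | v < i) size (adj v))%N | i <- iota 0 n.+1]
  ++ flatten [seq [seq nat_of_ord u | u <- adj v] | v <- enum 'I_n].

Definition input_state n (e : rel 'I_n) (adj : 'I_n -> seq 'I_n) : state :=
  State (nth 0 [:: n; num_edges e]) (nth 0 (input_words adj)).

(* Register 0 holds the address of the first output word, register 1 the number
   of output words. *)
Definition output_words (s : state) : seq nat :=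
  [seq mem s (regs s 0 + j) | j <- iota 0 (regs s 1)].

(* P, with words of log (n + m) + O(1) bits, outputs the vertex sequence p after
   t time units. *)
Definition outputs_path (P : prog) (c n : nat) (e : rel 'I_n)
    (adj : 'I_n -> seq 'I_n) (t : nat) (p : seq 'I_n) : Prop :=
  exists s, exec (c * (n + num_edges e)) P (input_state e adj) t s /\
            output_words s = [seq nat_of_ord v | v <- p].

(* Main.v *)
Require Import Defs.
From mathcomp Require Import zify lra.

Set Implicit Arguments.
Unset Strict Implicit.
Unset Printing Implicit Defensive.

Import Order.TTheory GRing.Theory Num.Theory.

(** Repeated breadth-first search, each started at the last vertex reached by
    the previous one, stops as soon as the eccentricity does not grow; the last
    two sources [x], [y] are then mutually farthest, and any shortest path from
    [x] to [y] is output.  In a graph satisfying the four-point condition with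
    defect [h], the second search already comes within [h] of the diameter, so
    there are at most [h + 3] searches; [h = 2 delta] in general, and tree-length
    [lambda] gives [h = 2 lambda].

    Let [q] be a shortest path of eccentricity [k] and [v] any vertex.

    Tree-length: some bag [B] separates [x], [y], [v] pairwise, and the output
    path meets it.  Vertices of [q] within [k] of [x], [y], [v] are linearly
    ordered along [q]; unless one of [x], [y], [v] is within [k] of [B], the
    middle one lies between two vertices of [B] on [q], hence within
    [lambda / 2] of [B].  So one of [x], [y], [v] is within
    [k + lambda / 2] of [B], and since [x] and [y] are mutually farthest, [v] is
    within [k + 3/2 lambda] of [B] in all cases.

    Hyperbolicity: the same ordering argument bounds the least of the three
    Gromov products of [x], [y], [v] by [k + h], and the one at [v] is the least
    because [x] and [y] are mutually farthest.  This gives eccentricity at most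
    [k + 2 h], which is below [k + 8 delta ln n] as [ln n >= 1/2] for [n > 1]. *)

(** * Distances and hyperbolicity *)

Section Distance.
Variables (T : finType) (e : rel T).
Hypothesis eP : connected_graph e.
Implicit Types (x y z u v w : T) (B S : {set T}).

Local Notation d := (dist e).

Lemma edge_sym : symmetric e. Proof. by case: eP. Qed.

Lemma walk_tupleP x y k :
  reflect (exists p, [/\ path e x p, last x p = y & size p = k])
          [exists p : k.-tuple T, path e x p && (last x p == y)].
Proof.
apply: (iffP existsP) => [[p /andP[xp /eqP xy]]|[p [xp xy /eqP sp]]].
  by exists p; rewrite size_tuple.
by exists (Tuple sp); rewrite xp xy eqxx.
Qed.


Lemma dist_walk x p : path e x p -> d x (last x p) <= size p.
Proof.
move=> xp; rewrite /dist; set P := (X in find X _).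
have Pp : P (size p) by apply/walk_tupleP; exists p.
case: (ltnP (size p) #|T|) => [ltp|]; last first.
  (* [find] never exceeds the length [#|T|] of the list it searches, which settles long walks. *)
  by apply: leq_trans; rewrite -[X in _ <= X](size_iota 0) find_size.
rewrite leqNgt; apply/negP => /(before_find 0).
by rewrite nth_iota // add0n Pp.
Qed.

(** Shortening a walk to distinct vertices brings its length below [#|T|], so the search defining
    [dist] succeeds. *)
Lemma geodesic x y :
  exists p, [/\ path e x p, last x p = y & size p = d x y].
Proof.
have [_ _ _ /(_ x y)/connectP[p0 xp0 ->]] := eP.
case/shortenP: xp0 => p xp up _.
have sp : size p < #|T| by have := card_uniqP up => /= <-; apply: max_card.
apply/walk_tupleP; rewrite /dist; set P := (X in find X _).
have hP : has P (iota 0 #|T|).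
  apply/hasP; exists (size p); first by rewrite mem_iota.
  by apply/walk_tupleP; exists p.
have := nth_find 0 hP; rewrite nth_iota //.
by move: hP; rewrite has_find size_iota.
Qed.

Lemma dist_refl x : d x x = 0.
Proof. by apply/eqP; rewrite -leqn0; apply: (@dist_walk x [::]). Qed.

Lemma dist_eq0 x y : d x y = 0 -> x = y.
Proof. by have [[|z p] [_ <- <-]] := geodesic x y. Qed.

Lemma dist_sym x y : d x y = d y x.
Proof.
suff le u v : d u v <= d v u by apply/eqP; rewrite eqn_leq !le.
have [p [vp <- <-]] := geodesic v u.
have := @dist_walk (last v p) (rev (belast v p)).
rewrite rev_path -(eq_path (e := e)); last by move=> a b; rewrite edge_sym.
rewrite size_rev size_belast => /(_ vp).
by case: p {vp} => [|z p] //=; rewrite rev_cons last_rcons.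
Qed.

Lemma dist_triangle x y z : d x z <= d x y + d y z.
Proof.
have [p [xp <- <-]] := geodesic x y; have [q [yq <- <-]] := geodesic (last x p) z.
by rewrite -last_cat -size_cat dist_walk // cat_path xp.
Qed.

Lemma dist_edge u v : e u v -> d u v <= 1.
Proof. by move=> uv; apply: (@dist_walk u [:: v]); rewrite /= uv. Qed.

Lemma dist_edgeS x u v : e u v -> d x v <= (d x u).+1.
Proof.
by move=> /dist_edge uv; apply: leq_trans (dist_triangle x u v) _; lia.
Qed.

Lemma dist_first x y : x != y -> exists2 z, e x z & d x y = (d z y).+1.
Proof.
have [[|z p] [/= xp <- sp]] := geodesic x y; first by rewrite eqxx.
case/andP: xp => xz zp _; exists z => //.
have := dist_walk zp; have := dist_triangle x z (last z p); have := dist_edge xz.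
lia.
Qed.

Lemma dist_last x y : x != y -> exists2 z, e z y & d x y = (d x z).+1.
Proof.
rewrite eq_sym => /dist_first[z]; rewrite edge_sym dist_sym (dist_sym z); by exists z.
Qed.

Lemma dist_lt_card x y : d x y < #|T|.
Proof.
have [_ _ _ /(_ x y)/connectP[p0 xp0 ->]] := eP.
case/shortenP: xp0 => p xp up _; apply: leq_ltn_trans (dist_walk xp) _.
by have := card_uniqP up => /= <-; apply: max_card.
Qed.

Lemma dist_set_le u v S : u \in S -> dist_set e v S <= d u v.
Proof.
move=> uS; have := mem_index_enum u; rewrite /dist_set.
elim: (index_enum T) => //= a s IH.
rewrite big_cons inE => /orP[/eqP<-|/IH us]; first by rewrite uS geq_minl.
by case: ifP => // _; apply: leq_trans us; apply: geq_minr.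
Qed.

(** The default [#|T|] of the minimum exceeds every distance, so it is harmless once [S] has an
    element. *)
Lemma dist_set_attained u0 v S :
  u0 \in S -> exists2 u, u \in S & d u v <= dist_set e v S.
Proof.
move=> u0S; rewrite /dist_set; elim/big_rec: _ => [|u m uS [u' u'S le]].
  by exists u0 => //; apply/ltnW/dist_lt_card.
by case: (leqP (d u v) m) => _; [exists u|exists u'].
Qed.

Lemma path_ecc_attained p v :
  shortest_path e p -> exists2 u, u \in p & d u v <= path_ecc e p.
Proof.
case: p => // x p _; have xS : x \in [set z in x :: p] by rewrite inE mem_head.
have [u uS le] := dist_set_attained v xS; exists u; first by rewrite inE in uS.
by apply: leq_trans le _; apply: (leq_bigmax_cond (F := fun z => dist_set e z _)).
Qed.

Lemma path_ecc_le p k :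
  (forall v, exists2 u, u \in p & d u v <= k) -> path_ecc e p <= k.
Proof.
move=> le; apply/bigmax_leqP => v _; have [u up uv] := le v.
by apply: leq_trans uv; apply: dist_set_le; rewrite inE.
Qed.

(** Counting edges bounds the distances over the pieces before [i], from [i] to [j] and after [j];
    these bounds add up to the full distance, so each is attained. *)
Lemma dist_nth_shortest x p i j : shortest_path e (x :: p) ->
  i <= j <= size p -> d (nth x (x :: p) i) (nth x (x :: p) j) = j - i.
Proof.
case/andP=> /(pathP x) xp /eqP sp.
have le a b : a <= b <= size p -> d (nth x (x :: p) a) (nth x (x :: p) b) <= b - a.
  case/andP; elim: b => [|b IH] ab bp.
    by move: ab; rewrite leqn0 => /eqP->; rewrite dist_refl.
  move: ab; rewrite leq_eqVlt ltnS => /orP[/eqP->|ab]; first by rewrite dist_refl.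
  have := dist_edgeS (nth x (x :: p) a) (xp b bp).
  by have := IH ab (ltnW bp); move=> /=; lia.
move=> /andP[ij jp]; apply/eqP; rewrite eqn_leq le ?ij //=.
have := le 0 i; have := le j (size p);
rewrite !leqnn jp (leq_trans ij jp) /= => /(_ isT) h1 /(_ isT) h2.
have := dist_triangle x (nth x (x :: p) i) (last x p).
have := dist_triangle (nth x (x :: p) i) (nth x (x :: p) j) (last x p).
move: h1; rewrite -[nth x (x :: p) (size p)]/(nth x (x :: p) (size (x :: p)).-1).
by rewrite nth_last /=; lia.
Qed.

Definition between a b c := d a c = d a b + d b c.

Lemma shortest_path_between p a b c : shortest_path e p ->
  a \in p -> b \in p -> c \in p ->
  between a b c \/ between b a c \/ between a c b.
Proof.
case: p => // x p sp; rewrite -!index_mem /between => ap bp cp.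
rewrite -[a](nth_index x (s := x :: p)) -?index_mem //.
rewrite -[b](nth_index x (s := x :: p)) -?index_mem //.
rewrite -[c](nth_index x (s := x :: p)) -?index_mem //.
move: (index a _) (index b _) (index c _) ap bp cp => i j k.
rewrite /= !ltnS => ip jp kp.
(* With truncated subtraction, [(s - t) + (t - s)] is the absolute difference of the positions. *)
have E s t : s <= size p -> t <= size p ->
    d (nth x (x :: p) s) (nth x (x :: p) t) = (s - t) + (t - s).
  move=> sp' tp'; case/orP: (leq_total s t) => st.
    by rewrite dist_nth_shortest ?st //; lia.
  by rewrite dist_sym dist_nth_shortest ?st //; lia.
by rewrite !E //; lia.
Qed.

Definition farthest x y := forall z, d x z <= d x y.

(** The four-point condition in integer form: as all labellings are covered, the largest of the
    three sums exceeds the second by at most [h]. *)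
Definition hyp4 (h : nat) := forall u v w x,
  d u v + d w x <= maxn (d u w + d v x) (d u x + d v w) + h.

(** In the condition for [u], [v], [a], [b], distances from [u] are at most [d u v] and those from
    [v] at most [d v w], so [d u v] cancels. *)
Lemma farthest_diam h u v w : hyp4 h -> farthest u v -> farthest v w ->
  forall a b, d a b <= d v w + h.
Proof.
move=> hyp uv vw a b; have := hyp u v a b.
have := uv a; have := uv b; have := vw a; have := vw b; lia.
Qed.

(** * Eccentricity bound from the four-point condition *)

Section Hyperbolic.
Variables (h k : nat) (q : seq T).
Hypotheses (hyp : hyp4 h) (sq : shortest_path e q) (qk : path_ecc e q <= k).

(* [d w a + d w b - d a b] is twice the Gromov product of [a] and [b] at [w]. *)
Lemma gromov_product_middle w a b qw qa qb :
    d w qw <= k -> d a qa <= k -> d b qb <= k -> between qa qw qb ->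
  d w a + d w b <= d a b + 2 * (k + h) \/
  d w a + d a b <= d w b + 2 * (k + h) \/
  d w b + d a b <= d w a + 2 * (k + h).
Proof.
rewrite /between => wk ak bk bt.
(* If all alternatives fail, adding their negations in pairs puts [w] farther than [2 * (k + h)]
   from [a] and [b], hence [qw] farther than [k + 2 * h]. The instance with [qa] then gives
   [d qw a + d qw qb <= d a qb + h], and the other one [d qw a + d qw b <= d a b + 2 * h]. *)
have := hyp qw a qa qb; have := hyp qw b a qb.
have := dist_triangle w qw a; have := dist_triangle w qw b.
by rewrite (dist_sym qw qa) (dist_sym b a); lia.
Qed.

Lemma gromov_product_min x y v :
  d v x + d v y <= d x y + 2 * (k + h) \/
  d v x + d x y <= d v y + 2 * (k + h) \/
  d v y + d x y <= d v x + 2 * (k + h).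
Proof.
have near z : exists2 u, u \in q & d z u <= k.
  have [u uq uz] := path_ecc_attained z sq.
  by exists u; rewrite // dist_sym; apply: leq_trans qk.
have [qx qxq xk] := near x; have [qy qyq yk] := near y.
have [qv qvq vk] := near v.
case: (shortest_path_between sq qxq qvq qyq) => [b|[b|b]].
- have := gromov_product_middle vk xk yk b; lia.
- have := gromov_product_middle xk vk yk b; rewrite (dist_sym x v); lia.
- have := gromov_product_middle yk xk vk b.
  by rewrite (dist_sym y x) (dist_sym y v) (dist_sym x v); lia.
Qed.

Lemma mutual_path_ecc_hyp x p : shortest_path e (x :: p) ->
  farthest x (last x p) -> farthest (last x p) x -> path_ecc e (x :: p) <= k + 2 * h.
Proof.
move=> sp; have := sp => /andP[_ /eqP szp]; move: szp; set y := last x p => szp xy yx.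
apply: path_ecc_le => v.
(* The distance from [x] is the Gromov product of [v] and [y] at [x], rounded up. It balances the
   two sums in the four-point condition, so the chosen vertex is about [h] plus the Gromov product
   of [x] and [y] at [v] away from [v]; parity absorbs the rounding. *)
pose i := minn (d x y) ((d v x + d x y - d v y).+1)./2.
have ip : i <= size p by rewrite szp geq_minl.
exists (nth x (x :: p) i); first by rewrite mem_nth.
have D1 : d x (nth x (x :: p) i) = i.
  by rewrite -[x in d x _]/(nth x (x :: p) 0) dist_nth_shortest ?subn0.
have D2 : d (nth x (x :: p) i) y = d x y - i.
  rewrite -szp -(dist_nth_shortest sp (i := i) (j := size p)) ?ip ?leqnn //.
  by rewrite -[nth x (x :: p) (size p)]/(nth x (x :: p) (size (x :: p)).-1) nth_last.
have := hyp (nth x (x :: p) i) v x y; have := xy v; have := yx v.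
have := gromov_product_min x y v.
rewrite (dist_sym (nth x (x :: p) i) x) D1 D2 (dist_sym y x) (dist_sym y v) (dist_sym x v).
have := dist_triangle v x y; have := dist_triangle x v y.
by rewrite (dist_sym x v) /i; lia.
Qed.

End Hyperbolic.
End Distance.

(** * Separators and tree-length *)

Section Separation.
Variables (T : finType) (e : rel T).
Hypothesis eP : connected_graph e.
Implicit Types (x y z u v w : T) (B : {set T}).

Local Notation d := (dist e).

Definition avoiding B := [rel a b | [&& e a b, a \notin B & b \notin B]].

(** [~~ linked B x y] says that [B] separates [x] from [y], vertices of [B] counting as separated
    from everything; the first conjunct is there because [connect] is reflexive. *)
Definition linked B x y := (x \notin B) && connect (avoiding B) x y.

Lemma path_avoiding B x p :
  path (avoiding B) x p -> path e x p /\ all (fun a => a \notin B) p.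
Proof. by elim: p x => //= y p IH x /andP[/and3P[-> _ ->] /IH[-> ->]]. Qed.

Lemma linked_end B x y : linked B x y -> y \notin B.
Proof.
case/andP=> xB /connectP[p /path_avoiding[_ /allP pB] ->].
by have := mem_last x p; rewrite inE => /orP[/eqP->|/pB].
Qed.

Lemma linked_sym B x y : linked B x y -> linked B y x.
Proof.
move=> xy; rewrite /linked (linked_end xy) sym_connect_sym; first by case/andP: xy.
by move=> a b; rewrite /= (edge_sym eP) (andbC (a \notin B)).
Qed.

Lemma linked_trans B y x z : linked B x y -> linked B y z -> linked B x z.
Proof. by case/andP=> xB xy /andP[_ yz]; rewrite /linked xB (connect_trans xy). Qed.

Lemma walk_linked B x p : path e x p ->
  has [in B] (x :: p) || linked B x (last x p).
Proof.
elim: p x => [|y p IH] x /=; first by rewrite /linked connect0 andbT; case: (x \in B).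
case/andP=> xy /IH /=; case: (boolP (x \in B)) => //= xB.
case: (boolP (y \in B)) => //= yB /orP[->//|/andP[_ yp]].
by rewrite /linked xB (connect_trans (connect1 _) yp) ?orbT //= xy xB.
Qed.

(** A geodesic from [x] to [y] either meets [B] or is itself a walk outside [B]. *)
Lemma between_or_linked B x y :
  (exists2 z, z \in B & between e x z y) \/ linked B x y.
Proof.
have [p [xp <- sp]] := geodesic eP x y.
case/orP: (walk_linked B xp) => [|]; last by right.
case/hasP=> z zp zB; left; exists z => //; rewrite /between.
have [p1 [p2 [Ep Ez]]] : exists p1 p2 : seq T, p = p1 ++ p2 /\ last x p1 = z.
  by case/splitPl: zp => p1 p2 <-; exists p1, p2.
move: xp sp; rewrite {}Ep cat_path size_cat last_cat -Ez.
case/andP=> /dist_walk + /dist_walk.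
by have := dist_triangle eP x (last x p1) (last (last x p1) p2); lia.
Qed.

End Separation.

Lemma is_tree_connected (I : finType) (r : rel I) : is_tree r -> connected_graph r.
Proof. by case. Qed.

(** * Medians in trees *)

Section TreeMedian.
Variables (I : finType) (r : rel I).
Hypothesis rT : is_tree r.
Let rC := is_tree_connected rT.
Local Notation d := (dist r).

(** If the first steps from [m] towards [i] and [j] differed, a path avoiding [m] would join them
    and close up through [m] to a cycle of length at least three. *)
Lemma linked_common_step m i j : linked r [set m] i j ->
  exists2 m', r m m' & d m i = (d m' i).+1 /\ d m j = (d m' j).+1.
Proof.
have step a : a \notin [set m] ->
    exists m', [/\ r m m', d m a = (d m' a).+1 & linked r [set m] m' a].
  rewrite inE eq_sym => /(dist_first rC)[m' mm' E]; exists m'; split=> //.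
  (* A geodesic from [m'] to [a] cannot return to [m], which is farther from [a]. *)
  case: (between_or_linked rC [set m] m' a) => [[z /set1P->]|//].
  by rewrite /between E; lia.
move=> ij; have [mi [rmi Ei li]] := step i (andP ij).1.
have [mj [rmj Ej lj]] := step j (linked_end ij).
have [eq_ij|ne_ij] := eqVneq mi mj; first by exists mi => //; rewrite eq_ij in Ei *.
have /andP[miB /connectP[p0 p0P Ep0]] :=
  linked_trans (linked_trans li ij) (linked_sym rC lj).
case/shortenP: p0P Ep0 => p /path_avoiding[rp /allP pB] up _ Ep.
have [rsym _ _ _ /(_ (m :: mi :: p))] := rT.
rewrite /ucycle /cycle /= rmi rcons_path rp -Ep rsym rmj /= -/(uniq (mi :: p)) up andbT.
rewrite inE negb_or; move: miB; rewrite inE eq_sym => ->.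
have -> : m \notin p by apply/negP => /pB; rewrite inE eqxx.
by move=> /(_ isT); case: (p) Ep => //= Ep; rewrite Ep eqxx in ne_ij.
Qed.

(* A node minimising the sum of the distances to [i], [j] and [k]: a path
   between two of them avoiding it would give a better neighbour. *)
Lemma tree_median i j k : exists m,
  [/\ ~~ linked r [set m] i j, ~~ linked r [set m] i k & ~~ linked r [set m] j k].
Proof.
pose f m := d m i + d m j + d m k.
case: (arg_minnP f (erefl true) : extremum_spec leq xpredT f [arg min_(m < i) f m]).
move=> m _ min; exists m.
have le m' a : r m m' -> d m' a <= (d m a).+1.
  move=> mm'; have := dist_edge mm'; have := dist_triangle rC m' m a.
  by rewrite (dist_sym rC m' m); lia.
split; apply/negP => /linked_common_step[m' mm' [E1 E2]]; have := min m' isT;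
  rewrite /f E1 E2.
- by have := le m' k mm'; lia.
- by have := le m' j mm'; lia.
- by have := le m' i mm'; lia.
Qed.

End TreeMedian.

(** * Bags as separators and the tree-length bound *)

Section TreeLength.
Variables (T : finType) (e : rel T).
Hypothesis eP : connected_graph e.
Implicit Types (x y z u v w : T) (B : {set T}).

Local Notation d := (dist e).

(** Consecutive vertices of a walk share a bag, and the bags of a vertex outside [bag m] are
    connected to each other without using [m]; concatenation gives a walk in the tree. *)
Lemma bag_linked (I : finType) (r : rel I) bag m x y i j :
    tree_decomposition e r bag -> x \in bag i -> y \in bag j ->
  linked e (bag m) x y -> linked r [set m] i j.
Proof.
case=> rT _ ebag cbag.
have sub a i1 i2 : a \notin bag m -> a \in bag i1 -> a \in bag i2 ->
    linked r [set m] i1 i2.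
  move=> am ai1 ai2; have ne b : a \in bag b -> b != m.
    by apply: contraTneq => ->.
  rewrite /linked inE ne //=; apply: connect_sub (cbag _ _ _ ai1 ai2) => b1 b2.
  by case/and3P=> rb a1 a2; apply: connect1; rewrite /= rb !inE !ne.
move=> xi yj /andP[xm /connectP[p xp Ey]].
elim: p x i xi xm xp Ey => [|z p IH] x i xi xm /=.
  by move=> _ Ey; apply: (sub x) => //; rewrite -Ey.
case/andP=> /and3P[exz _ zm] zp Ey.
have [i' /andP[xi' zi']] := ebag _ _ exz.
by apply: linked_trans (sub _ _ _ xm xi xi') (IH _ _ zi' zm zp Ey).
Qed.

Variable lambda : nat.
Hypothesis tl : has_tree_length e lambda.

(** The bag at a median of three nodes whose bags contain [x], [y] and [v]. *)
Lemma separating_bag x y v : exists B : {set T},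
  [/\ forall a b, a \in B -> b \in B -> d a b <= lambda,
      ~~ linked e B x y, ~~ linked e B x v & ~~ linked e B y v].
Proof.
have [I [r [bag [td diam]]]] := tl; have [rT vbag _ _] := td.
have [i xi] := vbag x; have [j yj] := vbag y; have [k vk] := vbag v.
have [m [mij mik mjk]] := tree_median rT i j k.
exists (bag m); split; first exact: diam.
- exact: contra (bag_linked td xi yj) mij.
- exact: contra (bag_linked td xi vk) mik.
- exact: contra (bag_linked td yj vk) mjk.
Qed.

Lemma separated_between B x y : ~~ linked e B x y ->
  exists2 z, z \in B & between e x z y.
Proof. by case: (between_or_linked eP B x y) => // ->. Qed.

Lemma tree_length_hyp4 : hyp4 e (2 * lambda).
Proof.
move=> u v w x; have [B [diam uv uw vw]] := separating_bag u v w.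
(* Both geodesics cross [B], and exchanging their ends at the crossings costs at most [lambda] for
   each new pair. *)
have key a b : ~~ linked e B u a -> ~~ linked e B v b ->
    d u v + d a b <= d u a + d v b + 2 * lambda.
  move=> /separated_between[z1 z1B E1] /separated_between[z2 z2B E2].
  have := dist_triangle eP u z1 v; have := dist_triangle eP z1 z2 v.
  have := dist_triangle eP a z1 b; have := dist_triangle eP z1 z2 b.
  have := diam _ _ z1B z2B; move: E1 E2; rewrite /between.
  by rewrite (dist_sym eP a z1) (dist_sym eP z2 v); lia.
(* If [x] lies on the side of [v], it is separated from [u], and the other pairing is used. *)
case: (boolP (linked e B v x)) => vx; last by have := key w x uw vx; lia.
have ux : ~~ linked e B u x.
  by apply: contra uv => ux; apply: linked_trans ux (linked_sym eP vx).
by have := key x w ux vw; rewrite (dist_sym eP x w); lia.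
Qed.

Section Eccentricity.
Variables (k : nat) (q : seq T).
Hypotheses (sq : shortest_path e q) (qk : path_ecc e q <= k).

(** Unless a geodesic from [w], [a] or [b] to its vertex of [q] meets [B], the set [B] also
    separates [qw] from [qa] and [qb]. Since [qw] is between these, its distances to the two
    crossings add up to at most [lambda], and the nearer crossing serves. *)
Lemma near_separator_middle B w a b qw qa qb :
    (forall a b, a \in B -> b \in B -> d a b <= lambda) ->
    ~~ linked e B w a -> ~~ linked e B w b ->
    d w qw <= k -> d a qa <= k -> d b qb <= k -> between e qa qw qb ->
  exists2 z, z \in B & 2 * d w z <= 2 * k + lambda \/
    2 * d a z <= 2 * k + lambda \/ 2 * d b z <= 2 * k + lambda.
Proof.
move=> diam wa wb wk ak bk bt.
have far x qx : d x qx <= k ->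
    (exists2 z, z \in B & 2 * d x z <= 2 * k + lambda) \/ linked e B x qx.
  case: (between_or_linked eP B x qx) => [[z zB E]|]; last by right.
  by move=> xk; left; exists z => //; move: E; rewrite /between; lia.
case: (far w qw wk) => [[z zB ?]|lw]; first by exists z; auto.
case: (far a qa ak) => [[z zB ?]|la]; first by exists z; auto.
case: (far b qb bk) => [[z zB ?]|lb]; first by exists z; auto.
have cross x qx : ~~ linked e B w x -> linked e B x qx -> ~~ linked e B qw qx.
  move=> wx lx; apply: contra wx => l.
  by apply: linked_trans lw (linked_trans l (linked_sym eP lx)).
have [z1 z1B E1] := separated_between (cross _ _ wa la).
have [z2 z2B E2] := separated_between (cross _ _ wb lb).
have := diam _ _ z1B z2B; move: bt E1 E2; rewrite /between => bt E1 E2 ?.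
have := dist_triangle eP qa z1 qb; have := dist_triangle eP z1 z2 qb.
have := dist_triangle eP w qw z1; have := dist_triangle eP w qw z2.
rewrite (dist_sym eP qa z1) (dist_sym eP qa qw) in bt *.
by case: (leqP (d qw z1) (d qw z2)) => *; [exists z1|exists z2]; lia.
Qed.

Lemma near_separator B x y v :
    (forall a b, a \in B -> b \in B -> d a b <= lambda) ->
    ~~ linked e B x y -> ~~ linked e B x v -> ~~ linked e B y v ->
  exists2 z, z \in B & 2 * d v z <= 2 * k + lambda \/
    2 * d x z <= 2 * k + lambda \/ 2 * d y z <= 2 * k + lambda.
Proof.
move=> diam xy xv yv.
have sep_sym a b : ~~ linked e B a b -> ~~ linked e B b a.
  by apply: contra; apply: linked_sym.
have near z : exists2 u, u \in q & d z u <= k.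
  have [u uq uz] := path_ecc_attained eP z sq.
  by exists u; rewrite // (dist_sym eP); apply: leq_trans qk.
have [qx qxq xk] := near x; have [qy qyq yk] := near y.
have [qv qvq vk] := near v.
case: (shortest_path_between eP sq qxq qvq qyq) => [b|[b|b]].
- by apply: near_separator_middle vk xk yk b; auto.
- by have [z ? ?] := near_separator_middle diam xv xy xk vk yk b; exists z => //; tauto.
- have [z ? ?] := near_separator_middle diam (sep_sym _ _ xy) yv yk xk vk b.
  by exists z => //; tauto.
Qed.

Lemma mutual_path_ecc_tree_length x p : shortest_path e (x :: p) ->
    farthest e x (last x p) -> farthest e (last x p) x ->
  2 * path_ecc e (x :: p) <= 2 * k + 5 * lambda.
Proof.
move=> /andP[xp _]; have := walk_linked _ xp; set y := last x p => meet xy yx.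
(* Eccentricities are integers, so the bound may be halved rounding down. *)
suff : path_ecc e (x :: p) <= (2 * k + 5 * lambda)./2 by lia.
apply: path_ecc_le => v.
have [B [diam sxy sxv syv]] := separating_bag x y v.
have := meet B; rewrite (negbTE sxy) orbF => /hasP[c cp cB]; exists c => //.
have [z zB zk] := near_separator diam sxy sxv syv.
(* [b] is no closer to [a] than to [v], and paths from [b] to [v] cross [B]. *)
have key a b : ~~ linked e B b v -> d b v <= d b a ->
    exists2 z', z' \in B & d z' v <= lambda + d a z.
  move=> /separated_between[z' z'B]; rewrite /between => E bv; exists z' => //.
  have := dist_triangle eP b z' a; have := dist_triangle eP z' z a.
  by have := diam _ _ z'B zB; rewrite (dist_sym eP z a); lia.
have [z1 z1B E1] := key x y syv (yx v); have [z2 z2B E2] := key y x sxv (xy v).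
(* If [v] is the vertex near [B], the route from [c] passes through [z]; if [x] or [y] is, it passes
   through [z1] or [z2] and costs [2 * lambda] plus the distance from that vertex to [z]. *)
have := dist_triangle eP c z v; have := dist_triangle eP c z1 v.
have := dist_triangle eP c z2 v; rewrite (dist_sym eP z v).
by have := diam _ _ cB zB; have := diam _ _ cB z1B; have := diam _ _ cB z2B; lia.
Qed.

End Eccentricity.
End TreeLength.

(** * Programs *)

Section Runs.
Variable W : nat.
Implicit Types (s : state) (P : prog) (a : expr) (Q : state -> Prop).

(** Total correctness within time [b]; nesting such postconditions executes a program symbolically,
    statement by statement. *)
Definition runs P s b Q := exists t s', [/\ exec W P s t s', t <= b & Q s'].

Lemma runs_weaken P s b b' Q Q' :
  runs P s b Q -> b <= b' -> (forall s', Q s' -> Q' s') -> runs P s b' Q'.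
Proof.
move=> [t [s' [ex tb Qs]]] bb QQ; exists t, s'; split; auto.
exact: leq_trans tb bb.
Qed.

Lemma runs_le P s b b' Q : runs P s b Q -> b <= b' -> runs P s b' Q.
Proof. by move=> r le; exact: runs_weaken r le (fun _ q => q). Qed.

Lemma runs_skip s Q : Q s -> runs Skip s 1 Q.
Proof. by exists 1, s; split=> //; constructor. Qed.

Lemma runs_assign x a s Q :
  eval s a < W -> Q (set_reg s x (eval s a)) -> runs (Assign x a) s (cost a).+1 Q.
Proof. by exists (cost a).+1, (set_reg s x (eval s a)); split=> //; constructor. Qed.

Lemma runs_write a a' s Q :
    eval s a < W -> eval s a' < W -> Q (set_mem s (eval s a) (eval s a')) ->
  runs (Write a a') s (cost a + cost a').+1 Q.
Proof.
exists (cost a + cost a').+1, (set_mem s (eval s a) (eval s a')).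
by split=> //; constructor.
Qed.

Lemma runs_seq P1 P2 s b1 b2 Q :
  runs P1 s b1 (fun s' => runs P2 s' b2 Q) -> runs (Seq P1 P2) s (b1 + b2) Q.
Proof.
case=> t1 [s1 [ex1 tb1 [t2 [s2 [ex2 tb2 Q2]]]]]; exists (t1 + t2), s2.
by split=> //; [apply: ExecSeq ex1 ex2|apply: leq_add].
Qed.

Lemma runs_if a P1 P2 s b Q :
    (eval s a != 0 -> runs P1 s b Q) -> (eval s a = 0 -> runs P2 s b Q) ->
  runs (If a P1 P2) s ((cost a).+1 + b) Q.
Proof.
move=> H1 H2; have [ea|ea] := eqVneq (eval s a) 0.
  have [t [s' [ex tb Qs]]] := H2 ea; exists ((cost a).+1 + t), s'.
  by split; [apply: ExecIfFalse|rewrite leq_add2l|].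
have [t [s' [ex tb Qs]]] := H1 ea; exists ((cost a).+1 + t), s'.
by split; [apply: ExecIfTrue|rewrite leq_add2l|].
Qed.

(* The invariant carries the remaining time budget, which also serves as the
   termination measure. *)
Lemma runs_while a P (Inv : nat -> state -> Prop) Q :
    (forall b s, Inv b s -> eval s a != 0 ->
       exists b1 b2, runs P s b1 (Inv b2) /\ (cost a).+1 + b1 + b2 <= b) ->
    (forall b s, Inv b s -> eval s a = 0 -> (cost a).+1 <= b /\ Q s) ->
  forall b s, Inv b s -> runs (While a P) s b Q.
Proof.
move=> step stop; elim/ltn_ind=> b IH s Is.
have [ea|ea] := eqVneq (eval s a) 0.
  have [cb Qs] := stop _ _ Is ea; exists (cost a).+1, s.
  by split=> //; constructor.
have [b1 [b2 [[t1 [s1 [ex1 tb1 I1]]] bb]]] := step _ _ Is ea.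
have [|t2 [s2 [ex2 tb2 Q2]]] := IH b2 _ s1 I1; first by lia.
exists ((cost a).+1 + t1 + t2), s2; split=> //; last by lia.
exact: ExecWhileTrue ea ex1 ex2.
Qed.

Lemma runs_while_stop a P s Q :
  eval s a = 0 -> Q s -> runs (While a P) s (cost a).+1 Q.
Proof. by exists (cost a).+1, s; split=> //; constructor. Qed.

Lemma runs_while_step a P s b1 b2 Q : eval s a != 0 ->
    runs P s b1 (fun s' => runs (While a P) s' b2 Q) ->
  runs (While a P) s ((cost a).+1 + b1 + b2) Q.
Proof.
move=> ea [t1 [s1 [ex1 tb1 [t2 [s2 [ex2 tb2 Q2]]]]]].
exists ((cost a).+1 + t1 + t2), s2.
by split=> //; [apply: ExecWhileTrue ex1 ex2|rewrite !leq_add].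
Qed.

End Runs.

(* Registers 2 to 5: the addresses of the adjacency lists, of the table of
   distances plus one (0 means unvisited), of the queue and of the parents.
   Registers 6 to 9: the current source, the previous source, one plus the
   eccentricity of the previous source, and a flag for the main loop.
   Registers 10 and 11: the head and the tail of the queue. *)
Definition reset_distances :=
  Seq (Assign 16 (Reg 3))
      (While (Sub (Reg 4) (Reg 16))
         (Seq (Write (Reg 16) (Const 0)) (Assign 16 (Add (Reg 16) (Const 1))))).

(** Registers 12 to 15: the vertex being scanned, the cursor and the end of its adjacency list, and
    the current neighbour. *)
Definition visit_neighbour :=
  If (Read (Add (Reg 3) (Reg 15))) Skip
     (Seq (Write (Add (Reg 3) (Reg 15))
                 (Add (Read (Add (Reg 3) (Reg 12))) (Const 1)))
     (Seq (Write (Add (Reg 5) (Reg 15)) (Reg 12))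
     (Seq (Write (Reg 11) (Reg 15))
          (Assign 11 (Add (Reg 11) (Const 1)))))).

Definition scan_neighbours :=
  While (Sub (Reg 14) (Reg 13))
    (Seq (Assign 15 (Read (Reg 13)))
    (Seq (Assign 13 (Add (Reg 13) (Const 1)))
         visit_neighbour)).

(** Truncated subtraction makes the guard the test that the head is before the tail. On exit
    register 12 still holds the last vertex dequeued, which is a farthest one. *)
Definition process_queue :=
  While (Sub (Reg 11) (Reg 10))
    (Seq (Assign 12 (Read (Reg 10)))
    (Seq (Assign 10 (Add (Reg 10) (Const 1)))
    (Seq (Assign 13 (Add (Reg 2) (Read (Reg 12))))
    (Seq (Assign 14 (Add (Reg 2) (Read (Add (Reg 12) (Const 1)))))
         scan_neighbours)))).

Definition bfs :=
  Seq reset_distances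
  (Seq (Write (Add (Reg 3) (Reg 6)) (Const 1))
  (Seq (Write (Add (Reg 5) (Reg 6)) (Reg 6))
  (Seq (Write (Reg 4) (Reg 6))
  (Seq (Assign 10 (Reg 4))
  (Seq (Assign 11 (Add (Reg 4) (Const 1)))
       process_queue))))).

(** Register 8 starts at 0, below every entry of a visited vertex, so the first round always
    continues. When the test fails, register 6 is still the root of the search in memory. *)
Definition bfs_round :=
  Seq bfs
  (If (Sub (Read (Add (Reg 3) (Reg 12))) (Reg 8))
     (Seq (Assign 8 (Read (Add (Reg 3) (Reg 12))))
     (Seq (Assign 7 (Reg 6))
          (Assign 6 (Reg 12))))
     (Assign 9 (Const 0))).

(** Parents are followed from register 7 to the root of the last search. The stored distance plus
    one is the number of vertices to output, and they overwrite the queue. *)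
Definition write_path :=
  Seq (Assign 12 (Reg 7))
  (Seq (Assign 11 (Read (Add (Reg 3) (Reg 7))))
  (Seq (Assign 1 (Const 0))
  (Seq (While (Sub (Reg 11) (Reg 1))
          (Seq (Write (Add (Reg 4) (Reg 1)) (Reg 12))
          (Seq (Assign 12 (Read (Add (Reg 5) (Reg 12))))
               (Assign 1 (Add (Reg 1) (Const 1))))))
       (Assign 0 (Reg 4))))).

(** The word at address [n] is the total length of the lists, so the tables start right after the
    input. *)
Definition mutual_path_prog :=
  Seq (Assign 2 (Add (Reg 0) (Const 1)))
  (Seq (Assign 3 (Add (Reg 2) (Read (Reg 0))))
  (Seq (Assign 4 (Add (Reg 3) (Reg 0)))
  (Seq (Assign 5 (Add (Reg 4) (Reg 0)))
  (Seq (Assign 6 (Const 0))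
  (Seq (Assign 7 (Const 0))
  (Seq (Assign 8 (Const 0))
  (Seq (Assign 9 (Const 1))
  (Seq (While (Reg 9) bfs_round)
       write_path)))))))).

(** * Layout of the input in memory *)

Lemma nth_flatten_offset (ss : seq (seq nat)) i j : j < size (nth [::] ss i) ->
  nth 0 (flatten ss) (sumn (take i (map size ss)) + j) = nth 0 (nth [::] ss i) j.
Proof.
elim: ss i => [|l ss IH] [|i] //=; rewrite nth_cat ?add0n; first by move->.
by move=> /IH <-; rewrite -addnA ltnNge leq_addr /= addKn.
Qed.

Section InputLayout.
Variables (n : nat) (e : rel 'I_n) (adj : 'I_n -> seq 'I_n).
Hypotheses (eP : connected_graph e) (adjP : adjacency_lists e adj).

Implicit Types u v : 'I_n.

Local Notation m := (num_edges e).

Definition offset i := \sum_(v < n | v < i) size (adj v).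
Definition input_mem a := nth 0 (input_words adj) a.

Lemma offsetS v : offset v.+1 = offset v + size (adj v).
Proof.
rewrite /offset (bigD1 v) //= addnC; congr (_ + _); apply: eq_bigl => u.
by rewrite ltnS ltn_neqAle andbC -(inj_eq val_inj).
Qed.

Lemma offset_sumn i : i <= n ->
  offset i = sumn (take i
    (map size [seq [seq nat_of_ord u | u <- adj v] | v <- enum 'I_n])).
Proof.
rewrite -map_comp; elim: i => [_|i IH lt_i]; first by rewrite take0 /offset big_pred0.
rewrite (offsetS (Ordinal lt_i)) IH ?(ltnW lt_i) //.
rewrite (take_nth 0); last by rewrite size_map size_enum_ord.
rewrite sumn_rcons.
rewrite (nth_map (Ordinal lt_i)) ?size_enum_ord //= size_map.
by congr (_ + size (adj _)); apply: val_inj; rewrite /= nth_enum_ord.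
Qed.

Lemma input_mem_offset i : i <= n -> input_mem i = offset i.
Proof.
move=> le_i; rewrite /input_mem /input_words nth_cat size_map size_iota ltnS le_i.
by rewrite (nth_map 0) ?size_iota ?ltnS // nth_iota // ltnS.
Qed.

Lemma input_mem_adj v j : j < size (adj v) ->
  input_mem (n.+1 + offset v + j) = nth v (adj v) j.
Proof.
move=> lt_j; rewrite /input_mem /input_words nth_cat size_map size_iota.
rewrite -addnA ltnNge leq_addr /= addKn offset_sumn; last exact: ltnW.
have E : nth [::] [seq [seq nat_of_ord u | u <- adj v0] | v0 <- enum 'I_n] v
    = [seq nat_of_ord u | u <- adj v].
  by rewrite (nth_map v) ?size_enum_ord // nth_ord_enum.
by rewrite nth_flatten_offset E ?size_map // (nth_map v).
Qed.

(** Ordered adjacent pairs are increasing or decreasing, and swapping the entries exchanges the two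
    kinds. *)
Lemma handshake : \sum_(v < n) size (adj v) = 2 * m.
Proof.
have [es ei _ _] := eP.
have -> : \sum_(v < n) size (adj v) = #|[set a : 'I_n * 'I_n | e a.1 a.2]|.
  rewrite -sum1_card (eq_bigl (fun a : 'I_n * 'I_n => true && e a.1 a.2)); last first.
    by move=> a; rewrite inE.
  rewrite -(pair_big_dep xpredT (fun a b => e a b) (fun _ _ => 1)) /=.
  apply: eq_bigr => v _; have [u_adj E] := adjP v.
  rewrite sum1_card -(card_uniqP u_adj); apply: eq_card => u; exact: E.
pose lt := [set a : 'I_n * 'I_n | e a.1 a.2 & a.1 < a.2].
rewrite -(cardsID [set a : 'I_n * 'I_n | a.1 < a.2]).
have -> : [set a | e a.1 a.2] :&: [set a : 'I_n * 'I_n | a.1 < a.2] = lt.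
  by apply/setP => a; rewrite !inE.
have -> : [set a | e a.1 a.2] :\: [set a : 'I_n * 'I_n | a.1 < a.2]
    = [set (a.2, a.1) | a in lt].
  apply/setP => [[a b]]; rewrite !inE /=; apply/andP/imsetP => [[ab eab]|[[c c'] /=]].
    exists (b, a) => //; rewrite inE /= es eab ltn_neqAle leqNgt ab andbT.
    by apply: contraTneq eab => /val_inj ->; rewrite ei.
  by rewrite inE /= => /andP[ec lt_c] [-> ->]; rewrite es ec -leqNgt ltnW.
rewrite card_imset; first by rewrite mul2n -addnn.
by move=> [a b] [c c'] [-> ->].
Qed.

Lemma offset_n : offset n = 2 * m.
Proof. by rewrite -handshake; apply: eq_bigl => v; apply: ltn_ord. Qed.

Lemma offset_le v : offset v.+1 <= 2 * m.
Proof.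
rewrite -handshake /offset big_mkcond /=; apply: leq_sum => u _.
by case: ifP.
Qed.

End InputLayout.

(** * Breadth-first search *)

Section BfsOrder.
Variables (T : finType) (e : rel T) (src : T).
Hypothesis eP : connected_graph e.
Implicit Types (u v w : T) (qs : seq T).

Local Notation d := (dist e src).

(** [qs] lists all vertices ever enqueued, [closed] those whose adjacency lists have been fully
    scanned. *)
Record bfs_order qs (closed : seq T) : Prop := BfsOrder {
  bfs_uniq : uniq qs;
  bfs_src : src \in qs;
  bfs_sorted : pairwise (fun a b => d a <= d b) qs;
  bfs_closed : forall a b, a \in closed -> e a b -> b \in qs
}.

(** Induction on the distance: the predecessor of [v] on a geodesic has been scanned, so [v] has
    been enqueued, and sortedness places it before [u]. *)
Lemma bfs_lower_layer done u pend : bfs_order (done ++ u :: pend) done ->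
  forall v, d v < d u -> v \in done.
Proof.
case=> _ src_in; rewrite pairwise_cat => /and3P[_ _ /= /andP[/allP u_min _]] cl v.
move: {2}(d v) (leqnn (d v)) => k; elim: k v => [|k IH] v dk dv.
all: have v_notin : v \notin u :: pend.
1,3: by rewrite inE; apply/norP; split; [apply: contraTneq dv => ->; rewrite ltnn|
       apply: contraTN dv => /u_min; rewrite -leqNgt].
all: suff : v \in done ++ u :: pend by rewrite mem_cat (negbTE v_notin) orbF.
all: have [<-//|/(dist_last eP)[z zv Ez]] := eqVneq src v.
  by rewrite Ez in dk.
by apply: cl zv; apply: IH; lia.
Qed.

(** Were [w] no farther than [u], its predecessor would lie in a lower layer, hence be scanned, and
    [w] would be enqueued already. *)
Lemma bfs_new_dist done u pend w : bfs_order (done ++ u :: pend) done ->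
  e u w -> w \notin done ++ u :: pend -> d w = (d u).+1.
Proof.
move=> ord uw wn; apply/eqP; rewrite eqn_leq (dist_edgeS eP src uw) /= ltnNge.
apply/negP => le_wu; case: (eqVneq src w) => [E|/(dist_last eP)[z zw Ez]].
  by move: wn; rewrite -E (bfs_src ord).
by case/negP: wn; apply: (bfs_closed ord) zw; apply: (bfs_lower_layer ord); lia.
Qed.

Lemma bfs_order_push qs closed w : bfs_order qs closed -> w \notin qs ->
  (forall b, b \in qs -> d b <= d w) -> bfs_order (rcons qs w) closed.
Proof.
case=> uq sq pq cq wn dw; split.
- by rewrite rcons_uniq wn.
- by rewrite mem_rcons inE sq orbT.
- by rewrite pairwise_rcons pq andbT; apply/allP.
- by move=> a b /cq h /h; rewrite mem_rcons inE orbC => ->.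
Qed.

Lemma bfs_order_complete qs v : bfs_order qs qs -> v \in qs.
Proof.
case=> _ sq _ cl; have [_ _ _ /(_ src v)/connectP[p + ->]] := eP.
by elim: p src sq => //= y p IH x xq /andP[xy]; apply/IH/cl/xy.
Qed.

Lemma bfs_last_farthest qs u : bfs_order (rcons qs u) (rcons qs u) -> farthest e src u.
Proof.
move=> ord v; have := bfs_order_complete v ord.
have := bfs_sorted ord; rewrite pairwise_rcons mem_rcons inE => /andP[/allP le _].
by case/orP => [/eqP->//|/le].
Qed.

End BfsOrder.

(** * The search in memory: invariants and running time *)

Section Bfs.
Variables (n : nat) (e : rel 'I_n) (adj : 'I_n -> seq 'I_n) (W : nat).
Hypotheses (eP : connected_graph e) (adjP : adjacency_lists e adj).
Implicit Types (u v w src : 'I_n) (qs : seq 'I_n) (M : nat -> nat) (s : state).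

Local Notation m := (num_edges e).
Local Notation DB := (n.+1 + 2 * m).
Local Notation QB := (n.+1 + 2 * m + n).
Local Notation PB := (n.+1 + 2 * m + n + n).

Hypothesis W_large : PB + n < W.

Definition static s :=
  [/\ regs s 0 = n, regs s 2 = n.+1, regs s 3 = DB, regs s 4 = QB & regs s 5 = PB].

Definition input_kept M := forall a, a < DB -> M a = input_mem adj a.

Definition same_regs s s' := forall r, r < 10 -> regs s' r = regs s r.

Lemma static_same s s' : same_regs s s' -> static s -> static s'.
Proof. by move=> ss [*]; rewrite /static !ss. Qed.

Lemma runs_reset s : static s -> input_kept (mem s) ->
  runs W reset_distances s (20 * n + 10) (fun s' =>
    [/\ same_regs s s', input_kept (mem s') & forall v, mem s' (DB + v) = 0]).
Proof.
move=> st inp; have [r0 r2 r3 r4 r5] := st.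
pose Inv b s' := exists i, [/\ i <= n, regs s' 16 = DB + i, same_regs s s',
  input_kept (mem s') & (forall j, j < i -> mem s' (DB + j) = 0) /\ b = 20 * (n - i) + 4].
apply: (runs_le (b := 2 + (20 * n + 4))); last lia.
apply/runs_seq/runs_assign; rewrite /= r3; first lia.
apply: (@runs_while _ _ _ Inv)
  => [b s' [i [ile r16 sr ik [z ->]]] /= |b s' [i [ile r16 sr ik [z ->]]] /= |].
- rewrite sr // r4 r16 => ne; exists 8, (20 * (n - i.+1) + 4); split; last lia.
  apply: (runs_le (b := 3 + 4)); last lia.
  apply/runs_seq/runs_write; rewrite /= ?r16; [lia|lia|].
  apply: runs_assign => /=; rewrite r16; first lia.
  exists i.+1; split=> /=; [lia|lia| | |].
  - by move=> r r10; rewrite /= ifN ?sr //; lia.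
  - by move=> a aD /=; rewrite ifN ?ik //; lia.
  by split=> // j ji; case: eqP => // ?; apply: z; lia.
- rewrite sr // r4 r16 => ne; split; first lia.
  by split=> // v; apply: z; have := ltn_ord v; lia.
- exists 0; split=> //=; [lia| |by split=> //; lia].
  by move=> r r10; rewrite /= ifN //; lia.
Qed.

(** The parent entry of the source need only be some vertex: the output loop reads it, and the value
    must fit in a word. *)
Record bfs_mem src M qs : Prop := BfsMem {
  bfs_input : input_kept M;
  bfs_dist : forall v, M (DB + v) = if v \in qs then (dist e src v).+1 else 0;
  bfs_queue : forall j, j < size qs -> M (QB + j) = nth src qs j;
  bfs_parent : forall v, v \in qs -> exists2 u : 'I_n, M (PB + v) = u &
    v != src -> e u v /\ dist e src v = (dist e src u).+1
}.

Lemma uniq_size_le qs : uniq qs -> size qs <= n.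
Proof. by move=> /card_uniqP <-; rewrite -[X in _ <= X](card_ord n) max_card. Qed.

Lemma bfs_mem_push src M M' qs u w :
    bfs_mem src M qs -> uniq qs -> w \notin qs -> e u w ->
    dist e src w = (dist e src u).+1 ->
    (forall a, M' a = if a == QB + size qs then nat_of_ord w else
       if a == PB + w then nat_of_ord u else
       if a == DB + w then (dist e src w).+1 else M a) ->
  bfs_mem src M' (rcons qs w).
Proof.
case=> ik Md Mq Mp uq wn uw dw E; have lt_w := ltn_ord w.
(* A vertex outside [qs] leaves room in the queue, which thus stays clear of the parents. *)
have lt_q : size qs < n by rewrite -[(size qs).+1]/(size (w :: qs)) uniq_size_le //= wn.
split.
- by move=> a aD; rewrite E !ifN ?ik //; lia.
- move=> v; have lt_v := ltn_ord v; rewrite E mem_rcons inE.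
  rewrite ifN; last by lia.
  rewrite ifN; last by lia.
  have [->|ne] := eqVneq v w; first by rewrite eqxx.
  by rewrite ifN ?Md // eqn_add2l.
- move=> j; rewrite size_rcons ltnS leq_eqVlt E nth_rcons => /orP[/eqP->|lt_j].
    by rewrite ltnn !eqxx.
  by rewrite lt_j !ifN ?Mq //; lia.
- move=> v; have lt_v := ltn_ord v; rewrite mem_rcons inE E.
  rewrite ifN; last by lia.
  have [->|ne] := eqVneq v w; first by rewrite eqxx; exists u.
  move=> /= /Mp[u' Eu' h]; exists u' => //.
  by rewrite !ifN ?eqn_add2l //; lia.
Qed.

(** The list of [u] is split into the neighbours already visited and those to come. The bound by
    [(dist e src u).+1] keeps the queue sorted when a new vertex is appended; the final 4 pays for
    the failing guard. *)
Definition scan_inv src s0 done u b s := exists pend seen todo,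
  let qs := done ++ u :: pend in
  [/\ adj u = seen ++ todo /\ b = 40 * size todo + 4,
      bfs_order e src qs done /\ bfs_mem src (mem s) qs,
      (forall a, a \in qs -> dist e src a <= (dist e src u).+1) /\ {subset seen <= qs},
      same_regs s0 s &
      [/\ regs s 10 = QB + (size done).+1, regs s 11 = QB + size qs,
      regs s 12 = u, regs s 13 = n.+1 + offset adj u + size seen &
      regs s 14 = n.+1 + offset adj u.+1]].

Lemma runs_scan src s0 done u b s : static s0 -> scan_inv src s0 done u b s ->
  runs W scan_neighbours s b (scan_inv src s0 done u 4).
Proof.
move=> st.
apply: runs_while => {b s} b s [pend [seen [todo]]] /=.
  move=> [[Ea ->] [ord Mm] [le_u sub] sr [r10 r11 r12 r13 r14]].
  have [_ _ r3 _ r5] := static_same sr st.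
  rewrite r13 r14 offsetS => ne.
  case: todo => [|w todo] in Ea *; first by rewrite Ea cats0 in ne; lia.
  exists 34, (40 * size todo + 4); split; last by move=> /=; lia.
  have lt_w := ltn_ord w; have lt_u := ltn_ord u.
  have := offset_le eP adjP u; rewrite offsetS Ea size_cat /= => le_off.
  have Ew : mem s (regs s 13) = w.
    rewrite r13 (bfs_input Mm) ?input_mem_adj ?Ea ?size_cat //=; try lia.
    by rewrite nth_cat ltnn subnn.
  have uw : e u w by have [_ <-] := adjP u; rewrite Ea mem_cat mem_head orbT.
  apply: (runs_le (b := 3 + (4 + (5 + 22)))); last lia.
  apply/runs_seq/runs_assign; rewrite /= Ew; first lia.
  apply/runs_seq/runs_assign; rewrite /= r13; first lia.
  have qn : size (done ++ u :: pend) <= n := uniq_size_le (bfs_uniq ord).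
  apply: runs_if => /=; rewrite r3 (bfs_dist Mm) /=.
    case: ifP => // wq _; apply: (runs_le (b := 1)) => //; apply: runs_skip.
    exists pend, (rcons seen w), todo; split=> //=.
    - by rewrite Ea cat_rcons.
    - by split=> // a; rewrite mem_rcons inE => /orP[/eqP->|/sub].
    - by move=> r r10'; rewrite /= !ifN ?sr //; lia.
    - by rewrite size_rcons r14; split=> //; lia.
  case: ifP => // wq _; have wn : w \notin done ++ u :: pend by rewrite wq.
  have qn' : size (done ++ u :: pend) < n.
    by rewrite -[_.+1]/(size (w :: (done ++ u :: pend))) uniq_size_le //= wn (bfs_uniq ord).
  have dw := bfs_new_dist eP ord uw wn.
  have uq : u \in done ++ u :: pend by rewrite mem_cat mem_head orbT.
  have dn := dist_lt_card eP src w; rewrite card_ord in dn.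
  apply: (runs_le (b := 10 + (5 + (3 + 4)))); last lia.
  apply/runs_seq/runs_write; rewrite /= ?r3 ?r12 ?(bfs_dist Mm) ?uq; [lia|lia|].
  apply/runs_seq/runs_write; rewrite /= ?r5 ?r12; [lia|lia|].
  apply/runs_seq/runs_write; rewrite /= ?r11; [lia|lia|].
  apply/runs_assign; rewrite /= ?r11; first lia.
  exists (rcons pend w), (rcons seen w), todo.
  rewrite -rcons_cons -rcons_cat /=; split=> //=.
  - by rewrite Ea cat_rcons.
  - split.
      apply: bfs_order_push => // a /le_u; by rewrite dw.
    apply: bfs_mem_push Mm (bfs_uniq ord) wn uw (dw) _ => a /=.
    by rewrite dw addn1.
  - split=> a; rewrite !mem_rcons !inE => /orP[/eqP->|].
    + by rewrite dw.
    + exact: le_u.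
    + by rewrite eqxx.
    + by move=> /sub ->; rewrite orbT.
  - by move=> r r10'; rewrite /= !ifN ?sr //; lia.
  - by rewrite !size_rcons r14; split=> //; lia.
move=> [[Ea ->] [ord Mm] [le_u sub] sr [r10 r11 r12 r13 r14]].
rewrite r13 r14 offsetS Ea size_cat => ne.
have Et : todo = [::] by case: todo {Ea} ne => //= *; lia.
rewrite {}Et in Ea *; split=> //.
by exists pend, seen, [::]; rewrite r13 r14 r12 r11 r10.
Qed.


Definition scan_cost v := 30 + 40 * size (adj v).

(** The amortised budget: each vertex is dequeued once, at a cost linear in its degree. *)
Definition remaining_cost (done : seq 'I_n) := \sum_(v | v \notin done) scan_cost v.

Lemma remaining_cost_rcons (done : seq 'I_n) u : u \notin done ->
  remaining_cost done = scan_cost u + remaining_cost (rcons done u).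
Proof.
move=> un; rewrite /remaining_cost (bigD1 u) //=; congr (_ + _); apply: eq_bigl => v.
by rewrite mem_rcons inE negb_or andbC.
Qed.

Definition bfs_result src s0 s := exists qs u,
  [/\ bfs_mem src (mem s) qs, forall v, v \in qs, same_regs s0 s,
      regs s 12 = u & farthest e src u].

(** The third clause is the layer property: no vertex reached lies more than one layer beyond a
    waiting one. *)
Definition queue_inv src s0 b s := exists done pend,
  let qs := done ++ pend in
  [/\ b = remaining_cost done + 4,
      bfs_order e src qs done /\ bfs_mem src (mem s) qs,
      forall a c, a \in pend -> c \in qs -> dist e src c <= (dist e src a).+1,
      same_regs s0 s &
      [/\ regs s 10 = QB + size done, regs s 11 = QB + size qs &
          done = [::] \/ regs s 12 = last src done]].

Lemma runs_process_queue src s0 b s : static s0 -> queue_inv src s0 b s ->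
  runs W process_queue s b (bfs_result src s0).
Proof.
move=> st; have [r0 r2 r3 r4 r5] := st.
apply: runs_while => {b s} b s [done [pend]] /=.
  move=> [-> [ord Mm] le_p sr [r10 r11 r12]].
  rewrite r10 r11 size_cat => ne.
  case: pend => [|u pend] in ord Mm le_p r11 ne *; first by move: ne => /=; lia.
  have lt_u := ltn_ord u; have := bfs_uniq ord; rewrite cat_uniq /= => /and3P[_ + _].
  rewrite negb_or => /andP[un _]; rewrite (remaining_cost_rcons un).
  exists (23 + 40 * size (adj u)), (remaining_cost (rcons done u) + 4).
  split; last by rewrite /scan_cost; lia.
  have Eu : mem s (regs s 10) = u.
    by rewrite r10 (bfs_queue Mm) ?nth_cat ?ltnn ?subnn // size_cat /=; lia.
  have E0 : mem s u = offset adj u.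
    by rewrite (bfs_input Mm) ?input_mem_offset //; lia.
  have E1 : mem s (u + 1) = offset adj u.+1.
    by rewrite addn1 (bfs_input Mm) ?input_mem_offset //; lia.
  have qn := uniq_size_le (bfs_uniq ord).
  have off := offset_le eP adjP u; have offS := offsetS adj u.
  have qn' : size done < n by move: qn; rewrite size_cat /=; lia.
  apply: (runs_le (b := 3 + (4 + (5 + (7 + (40 * size (adj u) + 4)))))); last lia.
  apply/runs_seq/runs_assign; rewrite /= Eu; first lia.
  apply/runs_seq/runs_assign; rewrite /= r10; first lia.
  apply/runs_seq/runs_assign; rewrite /= sr // r2 E0; first lia.
  apply/runs_seq/runs_assign; rewrite /= sr // r2 E1; first lia.
  apply: runs_weaken (leqnn _) _.
    apply: (runs_scan (src := src) (done := done) (u := u) st).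
    exists pend, [::], (adj u); split=> //=.
    - split=> // a aq; apply: le_p aq; exact: mem_head.
    - by move=> r r10'; rewrite /= !ifN ?sr //; lia.
    - by split=> //; lia.
  move=> s' [pend' [seen [todo /=
    [[Ea b4] [ord' Mm'] [le_u sub] sr' [r10' r11' r12' _ _]]]]].
  have Et : todo = [::] by case: todo b4 {Ea} => //= *; lia.
  rewrite Et cats0 in Ea; exists (rcons done u), pend'.
  rewrite cat_rcons size_rcons last_rcons.
  split=> //; last by split=> //; right.
    split=> //; case: ord' => uq sq pq cl; split=> // a c.
    rewrite mem_rcons inE => /orP[/eqP->|]; last exact: cl.
    by have [_ <-] := adjP u; rewrite Ea; apply: sub.
  move=> a c ap cq; apply: leq_trans (le_u c cq) _.
  have := bfs_sorted ord'; rewrite pairwise_cat /= => /and3P[_ _ /andP[/allP le _]].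
  exact: le.
move=> [-> [ord Mm] le_p sr [r10 r11 r12]].
rewrite r10 r11 size_cat => ne.
have Ep : pend = [::] by case: (pend) ne => //= *; lia.
rewrite {}Ep cats0 in ord Mm; split; first lia.
(* The source has been enqueued, so [done] has a last element, which register 12 holds. *)
case/lastP: done => [|done u] in ord Mm r12 le_p r10 r11 ne *; first by case: ord.
exists (rcons done u), u; split=> //.
- by move=> v; apply: bfs_order_complete ord.
- by case: r12 => [/(congr1 size)|]; rewrite ?size_rcons ?last_rcons.
- exact: bfs_last_farthest ord.
Qed.

Lemma runs_bfs src s : static s -> input_kept (mem s) -> regs s 6 = src ->
  runs W bfs s (50 * n + 80 * m + 50) (bfs_result src s).
Proof.
move=> st ik r6; have [r0 r2 r3 r4 r5] := st; have lt_s := ltn_ord src.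
(* Each edge occurs in two lists, so 40 per list entry becomes 80 per edge. *)
have E : \sum_v scan_cost v = 30 * n + 80 * m.
  rewrite big_split /= sum_nat_const card_ord -big_distrr /= (handshake eP adjP); lia.
apply: (runs_le
  (b := 20 * n + 10 + (5 + (5 + (3 + (2 + (4 + (\sum_v scan_cost v + 4)))))))).
- apply: runs_seq; apply: (runs_weaken (runs_reset st ik) (leqnn _)).
  move=> s1 [sr1 ik1 z1].
  apply/runs_seq/runs_write; rewrite /= ?sr1 // ?r3 ?r6; [lia|lia|].
  apply/runs_seq/runs_write; rewrite /= ?sr1 // ?r5 ?r6; [lia|lia|].
  apply/runs_seq/runs_write; rewrite /= ?sr1 // ?r4 ?r6; [lia|lia|].
  apply/runs_seq/runs_assign; rewrite /= ?sr1 // ?r4; [lia|].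
  apply/runs_seq/runs_assign; rewrite /= ?sr1 // ?r4; [lia|].
  apply: (runs_process_queue (src := src) st); exists [::], [:: src]; split=> /=.
  + by congr (_ + 4); apply: eq_bigl => v.
  + split; first by split=> //=; rewrite mem_head.
    split.
    * by move=> a aD /=; rewrite !ifN ?ik1 //; lia.
    * move=> v /=; have lt_v := ltn_ord v; rewrite inE ifN; last by lia.
      rewrite ifN; last by lia.
      rewrite eqn_add2l (inj_eq val_inj); case: eqP => [->|_]; last exact: z1.
      by rewrite dist_refl.
    * by case=> //= _; rewrite addn0 eqxx.
    * move=> v; rewrite inE => /eqP->; exists src; last by rewrite eqxx.
      by rewrite /= ifN ?eqxx //; lia.
  + by move=> a c; rewrite !inE => /eqP-> /eqP->.
  + by move=> r r10; rewrite /= !ifN ?sr1 //; lia.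
  + by split=> //; [lia|left].
- by rewrite E; lia.
Qed.

Definition round_result src s0 s := exists qs u,
  [/\ static s, bfs_mem src (mem s) qs, forall v, v \in qs, farthest e src u &
    if regs s0 8 < (dist e src u).+1 then
      [/\ regs s 6 = u, regs s 7 = src, regs s 8 = (dist e src u).+1 &
          regs s 9 = regs s0 9]
    else [/\ regs s 6 = src, regs s 7 = regs s0 7 & regs s 9 = 0]].

Lemma runs_round src s : static s -> input_kept (mem s) -> regs s 6 = src ->
  runs W bfs_round s (50 * n + 80 * m + 80) (round_result src s).
Proof.
move=> st ik r6; have [r0 r2 r3 r4 r5] := st; have lt_s := ltn_ord src.
apply: (runs_le (b := 50 * n + 80 * m + 50 + (7 + 9))); last lia.
apply: runs_seq; apply: (runs_weaken (runs_bfs st ik r6) (leqnn _)).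
move=> s1 [qs [u [Mm full sr r12 far]]]; have lt_u := ltn_ord u.
have st1 := static_same sr st.
have dn := dist_lt_card eP src u; rewrite card_ord in dn.
have Eu : mem s1 (regs s1 3 + regs s1 12) = (dist e src u).+1.
  by rewrite sr // r3 r12 (bfs_dist Mm) full.
apply: runs_if => /=; rewrite Eu sr // => ne.
  apply: (runs_le (b := 5 + (2 + 2))); last lia.
  apply/runs_seq/runs_assign; rewrite /= Eu; first lia.
  apply/runs_seq/runs_assign; rewrite /= sr // r6; first lia.
  apply/runs_assign; rewrite /= r12; first lia.
  exists qs, u; split=> //=.
  have -> : regs s 8 < (dist e src u).+1 by lia.
  by split=> //; rewrite /= sr.
apply: (runs_le (b := 2)); last lia.
apply/runs_assign; rewrite /=; first lia.
exists qs, u; split=> //=.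
have -> : (regs s 8 < (dist e src u).+1) = false by lia.
by split=> //; rewrite /= sr.
Qed.

End Bfs.

(** * The main loop and the output *)

Section MutualPath.
Variables (n : nat) (e : rel 'I_n) (adj : 'I_n -> seq 'I_n) (W : nat).
Hypotheses (eP : connected_graph e) (adjP : adjacency_lists e adj).
Implicit Types (u v w x y : 'I_n) (s : state).

Local Notation d := (dist e).
Local Notation m := (num_edges e).
Local Notation DB := (n.+1 + 2 * m).
Local Notation QB := (n.+1 + 2 * m + n).
Local Notation PB := (n.+1 + 2 * m + n + n).
Local Notation loop := (While (Reg 9) bfs_round).
Local Notation K := (50 * n + 80 * m + 80).

Hypothesis W_large : PB + n < W.

Definition pair_state x y s :=
  [/\ static e s, input_kept e adj (mem s), regs s 9 = 1,
      regs s 7 = x /\ regs s 6 = y &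
      regs s 8 = (d x y).+1 /\ farthest e x y].

Definition loop_result s := exists x y qs,
  [/\ static e s, bfs_mem e adj y (mem s) qs, forall v, v \in qs,
      regs s 7 = x & farthest e x y /\ farthest e y x].

Lemma runs_loop_step x y s b : pair_state x y s -> 2 <= b ->
    (forall u s', pair_state y u s' -> d x y < d y u -> runs W loop s' b loop_result) ->
  runs W loop s (K + 2 + b) loop_result.
Proof.
case=> st ik r9 [r7 r6] [r8 far] b2 next.
apply: (runs_le (b := 2 + K + b)); last lia.
apply: runs_while_step; first by rewrite /= r9.
apply: (runs_weaken (runs_round eP adjP W_large st ik r6) (leqnn _)).
move=> s' [qs [u [st' Mm full far']]]; rewrite r8 ltnS r7 r9.
case: ltnP => [lt [r6' r7' r8' r9']|le [r6' r7' r9']].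
  by apply: (next u) => //; split=> //; apply: bfs_input Mm.
apply: (runs_le (b := 2)) => //.
(* The search from [y] got no farther than [d x y], so [x] is farthest from [y] as well. *)
apply: runs_while_stop => //; exists x, y, qs; split=> //; split=> // z.
by apply: leq_trans (far' z) _; rewrite (dist_sym eP y x).
Qed.

(** [j] bounds how much [d x y] can still grow, and every continuing round increases it. *)
Lemma runs_loop j x y s : pair_state x y s -> (forall u v, d u v <= d x y + j) ->
  runs W loop s (j.+1 * (K + 2) + 2) loop_result.
Proof.
elim: j x y s => [|j IH] x y s ps diam; have := runs_loop_step ps.
  move=> /(_ 2 isT) step; rewrite mul1n; apply: step => u s' _.
  by have := diam y u; lia.
move=> /(_ (j.+1 * (K + 2) + 2)) step; rewrite mulSn -addnA; apply: step; first lia.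
by move=> u s' ps' lt; apply: IH ps' _ => a b; have := diam a b; lia.
Qed.

(** One search from an arbitrary source, one from the vertex it reaches, and by [farthest_diam] at
    most [h + 1] more. *)
Lemma runs_loop_first h s (src : 'I_n) :
    hyp4 e h -> static e s -> input_kept e adj (mem s) ->
    regs s 9 = 1 -> regs s 6 = src -> regs s 8 = 0 ->
  runs W loop s (h.+3 * (K + 2) + 2) loop_result.
Proof.
move=> hyp st ik r9 r6 r8.
apply: (runs_le (b := 2 + K + (K + 2 + (h.+1 * (K + 2) + 2)))).
  apply: runs_while_step; first by rewrite /= r9.
  apply: (runs_weaken (runs_round eP adjP W_large st ik r6) (leqnn _)).
  move=> s' [qs [u [st' Mm full far]]]; rewrite r8 r9 /= => -[r6' r7' r8' r9'].
  have ps : pair_state src u s' by split=> //; apply: bfs_input Mm.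
  apply: runs_loop_step ps _ _; first lia.
  move=> v s2 ps _; apply: runs_loop (ps) _; case: ps => _ _ _ _ [_ far'].
  exact: farthest_diam hyp far far'.
by rewrite !mulSn; lia.
Qed.

Lemma parent_chain y M qs : bfs_mem e adj y M qs -> (forall v, v \in qs) -> forall x,
  exists p, [/\ path e x p, last x p = y, size p = d y x &
    forall j, j < size p -> M (PB + nth y (x :: p) j) = nth y (x :: p) j.+1].
Proof.
move=> Mm full x; move: {2}(d y x) (erefl (d y x)) => k; elim: k x => [|k IH] x Ex.
  by exists [::]; rewrite Ex (dist_eq0 eP Ex).
have [u Eu par] := bfs_parent Mm (full x).
have [Exy|ne] := eqVneq x y; first by rewrite Exy dist_refl in Ex.
have [ux] := par ne; rewrite Ex => -[Eku]; have [p [up lp sp cp]] := IH u (esym Eku).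
exists (u :: p); rewrite /= (edge_sym eP) ux up sp Eku; split=> //.
by move=> [|j] lt_j //; apply: cp; lia.
Qed.

Lemma runs_write_path s : loop_result s ->
  runs W write_path s (20 * n + 40) (fun s' => exists x p,
    [/\ shortest_path e (x :: p), farthest e x (last x p), farthest e (last x p) x &
        output_words s' = [seq nat_of_ord v | v <- x :: p]]).
Proof.
case=> x [y [qs [st Mm full r7 [xy yx]]]]; have [r0 r2 r3 r4 r5] := st.
have lt_x := ltn_ord x; have dn := dist_lt_card eP y x; rewrite card_ord in dn.
have [p [xp lp sp cp]] := parent_chain Mm full x.
have Ex : mem s (DB + x) = (size p).+1 by rewrite (bfs_dist Mm) full sp.
(* The last iteration loads the parent entry of [y], so register 12 is specified only while
   [i <= size p]. *)
pose Inv b s' := exists i,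
  [/\ i <= (size p).+1 /\ b = 20 * ((size p).+1 - i) + 4,
      [/\ regs s' 1 = i, regs s' 4 = QB, regs s' 5 = PB & regs s' 11 = (size p).+1],
      i <= size p -> regs s' 12 = nth y (x :: p) i,
      forall j, j < i -> mem s' (QB + j) = nth y (x :: p) j &
      forall v, mem s' (PB + v) = mem s (PB + v)].
apply: (runs_le (b := 2 + (5 + (2 + (20 * (size p).+1 + 4 + 2))))).
  apply/runs_seq/runs_assign; rewrite /= r7; first lia.
  apply/runs_seq/runs_assign; rewrite /= r3 r7 Ex; first lia.
  apply/runs_seq/runs_assign; rewrite /=; first lia.
  apply: runs_seq; apply: (@runs_while _ _ _ Inv) => [b s'|b s'|].
  - case=> i [[ile ->] [r1' r4' r5' r11'] r12' out par] /=; rewrite r1' r11' => ne.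
    have ip : i <= size p by lia.
    exists 14, (20 * ((size p).+1 - i.+1) + 4); split; last lia.
    have lt_i := ltn_ord (nth y (x :: p) i).
    have [u Eu _] := bfs_parent Mm (full (nth y (x :: p) i)); have lt_u := ltn_ord u.
    apply: (runs_le (b := 5 + (5 + 4))); last lia.
    apply/runs_seq/runs_write; rewrite /= ?r4' ?r1' ?r12' //; [lia|lia|].
    have E : (PB + nth y (x :: p) i == QB + i) = false by lia.
    apply/runs_seq/runs_assign; rewrite /= r5' r12' // E par Eu; first lia.
    apply/runs_assign; rewrite /= r1'; first lia.
    exists i.+1; split=> /=.
    + by rewrite ltnS.
    + by split=> //; lia.
    + by move=> lt_ip; rewrite -cp // Eu.
    + move=> j ji; rewrite eqn_add2l; case: eqP => [->//|?]; apply: out; lia.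
    + by move=> v; have lt_v := ltn_ord v; rewrite ifN ?par //; lia.
  - case=> i [[ile ->] [r1' r4' r5' r11'] r12' out par] /=; rewrite r1' r11' => ne.
    split; first lia; apply: runs_assign; rewrite /= r4'; first lia.
    have {ne ile} Ei : i = (size p).+1 by lia.
    exists x, p; split.
    + by rewrite /= xp lp sp (dist_sym eP) eqxx.
    + by rewrite lp.
    + by rewrite lp.
    + rewrite [LHS](_ : _ = [seq mem s' (QB + j) | j <- iota 0 (size p).+1]); last first.
        by rewrite /output_words /= r1' Ei.
      rewrite -[RHS]/[seq nat_of_ord v | v <- x :: p].
      apply: (@eq_from_nth _ 0); first by rewrite !size_map size_iota.
      rewrite size_map size_iota => j lt_j.
      rewrite (nth_map 0) ?size_iota // nth_iota // (nth_map y) //.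
      by apply: out; rewrite Ei.
  - exists 0; split=> //=; by split=> //; lia.
by rewrite sp; lia.
Qed.

Lemma runs_mutual_path h : hyp4 e h ->
  runs W mutual_path_prog (input_state e adj) (h.+3 * (K + 2) + 20 * n + 80)
   (fun s' => exists x p,
    [/\ shortest_path e (x :: p), farthest e x (last x p), farthest e (last x p) x &
        output_words s' = [seq nat_of_ord v | v <- x :: p]]).
Proof.
move=> hyp; have [_ _ n_gt0 _] := eP; rewrite card_ord in n_gt0.
have En : nth 0 (input_words adj) n = 2 * m.
  by rewrite -[LHS]/(input_mem adj n) input_mem_offset // (offset_n eP adjP).
apply: (runs_le (b := 4 + (5 + (4 + (4 + (2 + (2 + (2 + (2 +
  (h.+3 * (K + 2) + 2 + (20 * n + 40))))))))))).
  apply/runs_seq/runs_assign; rewrite /= ?addn1; first lia.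
  apply/runs_seq/runs_assign; rewrite /= En; first lia.
  apply/runs_seq/runs_assign; rewrite /=; first lia.
  apply/runs_seq/runs_assign; rewrite /=; first lia.
  do 4! [apply/runs_seq/runs_assign; rewrite /=; first lia].
  apply: runs_seq; apply: (runs_weaken (b := h.+3 * (K + 2) + 2)) => //.
    by apply: (@runs_loop_first h _ (Ordinal n_gt0)).
  exact: runs_write_path.
lia.
Qed.

End MutualPath.

(** * The bounds *)

Section Output.
Variables (n : nat) (e : rel 'I_n) (adj : 'I_n -> seq 'I_n).
Hypotheses (eP : connected_graph e) (adjP : adjacency_lists e adj).
Local Notation m := (num_edges e).

Lemma mutual_path_output h : hyp4 e h -> exists t x p,
  [/\ outputs_path mutual_path_prog 6 e adj t (x :: p),
      t <= 300 * (h + 3) * (n + m), shortest_path e (x :: p) &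
      farthest e x (last x p) /\ farthest e (last x p) x].
Proof.
move=> hyp; have [_ _ n_gt0 _] := eP; rewrite card_ord in n_gt0.
(* [6 * (n + m)] exceeds [4 * n + 2 * m + 1], the end of the parent table. *)
have [|t [s [ex tb [x [p [sp xy yx out]]]]]] :=
  @runs_mutual_path n e adj (6 * (n + m)) eP adjP _ h hyp; first lia.
by exists t, x, p; split=> //; [exists s|nia].
Qed.

(** Every vertex has a neighbour, so the degrees sum to at least [n]; this absorbs [n] into the time
    bounds. *)
Lemma vertices_le_edges : 1 < n -> n <= 2 * m.
Proof.
move=> n1; rewrite -(handshake eP adjP) -{1}(card_ord n) -sum1_card.
apply: leq_sum => v _; have [_ _ _ conn] := eP.
have [u vu] : exists u : 'I_n, v != u.
  have [E|ne] := eqVneq v (Ordinal n1); last by exists (Ordinal n1).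
  by exists (Ordinal (ltnW n1)); rewrite E.
have [z vz _] := dist_first eP vu.
by have [_ adjv] := adjP v; move: vz; rewrite -adjv; case: (adj v).
Qed.

(** For a single vertex [m] and [ln n] vanish, so this case is treated apart, with defect 0. *)
Lemma one_vertex : n = 1 -> hyp4 e 0 /\ m = 0.
Proof.
move=> n1; have all_eq (u v : 'I_n) : u = v.
  by apply: val_inj; have := ltn_ord u; have := ltn_ord v; rewrite /=; lia.
split; first by move=> u v w x; rewrite (all_eq v u) (all_eq w u) (all_eq x u) dist_refl.
apply/eqP; rewrite cards_eq0; apply/eqP/setP => -[a b].
by rewrite !inE /= (all_eq a b) ltnn andbF.
Qed.

Lemma tree_length_gt0 lambda : 1 < n -> has_tree_length e lambda -> 0 < lambda.
Proof.
move=> n1 [I [r [bag [[_ _ ebag _] diam]]]].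
have ne : Ordinal (ltnW n1) != Ordinal n1 by [].
have [z vz _] := dist_first eP ne; have [i /andP[vi zi]] := ebag _ _ vz.
apply: leq_trans (diam i _ _ vi zi); rewrite lt0n; apply/eqP => /(dist_eq0 eP) E.
by have [_ ei _ _] := eP; rewrite E ei in vz.
Qed.

End Output.

(** * From real hyperbolicity to integer defects *)

Section RealBounds.
Variable R : realType.
Local Open Scope ring_scope.

Lemma hyperbolicity_ge0 (T : finType) (e : rel T) (delta : R) :
  connected_graph e -> has_hyperbolicity e delta -> 0 <= delta.
Proof.
case=> _ _ /card_gt0P[x _] _ /(_ x x x x); rewrite !dist_refl /= subrr; lra.
Qed.

(** Only the largest number can exceed both others, and then by the gap between the two largest. *)
Lemma le_max_sort3 (a b c : nat) : let s := sort geq [:: a; b; c] in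
  (a <= maxn b c + (nth 0 s 0 - nth 0 s 1))%N.
Proof. by rewrite /sort /=; repeat case: ifP => /=; lia. Qed.

(** The gap is an integer, so it is at most the integer part of [2 * delta]. *)
Lemma hyperbolicity_hyp4 (T : finType) (e : rel T) (delta : R) :
  connected_graph e -> has_hyperbolicity e delta -> hyp4 e (Num.truncn (2 * delta)).
Proof.
move=> eP hyp u v w x; have d0 := hyperbolicity_ge0 eP hyp.
have := le_max_sort3 (dist e u v + dist e w x) (dist e u w + dist e v x)
  (dist e u x + dist e v w).
move: (hyp u v w x) => /=; set s := sort _ _ => le_s le.
apply: leq_trans le _; rewrite leq_add2l.
have [le|lt] := leqP (nth 0%N s 0) (nth 0%N s 1).
  by move: le; rewrite -subn_eq0 => /eqP->.
by rewrite -[leqLHS](natrK (R := R)); apply: le_truncn; rewrite natrB // ltnW.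
Qed.

(** Apply [ln x <= x - 1] at the inverse of [n], which is at most one half. *)
Lemma ln_nat_ge_half (n : nat) : (1 < n)%N -> 1 / 2 <= ln (n%:R : R).
Proof.
move=> n1; have n2 : 2 <= n%:R :> R by rewrite ler_nat.
have n0 : 0 < n%:R :> R by lra.
have inv : n%:R^-1 <= 1 / 2 :> R by rewrite div1r lef_pV2 ?posrE //; lra.
have inv0 : 0 < n%:R^-1 :> R by rewrite invr_gt0.
have := @le_ln1Dx R (n%:R^-1 - 1); rewrite addrCA subrr addr0 lnV ?posrE //.
by move=> /(_ ltac:(lra)); lra.
Qed.

End RealBounds.

Local Open Scope ring_scope.

Theorem theorem5 (R : realType) :
  (exists (P : prog) (c C : nat),
     forall (n : nat) (e : rel 'I_n) (adj : 'I_n -> seq 'I_n)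
            (k lambda : nat),
       connected_graph e -> adjacency_lists e adj ->
       (exists q, shortest_path e q /\ path_ecc e q = k) ->
       has_tree_length e lambda ->
       exists (t : nat) (p : seq 'I_n),
         [/\ outputs_path P c e adj t p,
             (t <= C * maxn 1 (lambda * num_edges e))%N,
             shortest_path e p
           & (path_ecc e p)%:R <= k%:R + 5%:R / 2%:R * lambda%:R :> R])
  /\
  (exists (P : prog) (c C D : nat),
     forall (n : nat) (e : rel 'I_n) (adj : 'I_n -> seq 'I_n)
            (k : nat) (delta : R),
       connected_graph e -> adjacency_lists e adj ->
       (exists q, shortest_path e q /\ path_ecc e q = k) ->
       has_hyperbolicity e delta ->
       exists (t : nat) (p : seq 'I_n),
         [/\ outputs_path P c e adj t p,
             t%:R <= C%:R * (Num.max 1 delta * (maxn 1 (num_edges e))%:R) :> R,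
             shortest_path e p
           & (path_ecc e p)%:R <= k%:R + D%:R * (delta * ln (n%:R : R))]).
Proof.
split.
  exists mutual_path_prog, 6, 4500 => n e adj k lambda eP adjP [q [sq qk]] tl.
  have [_ _ n_gt0 _] := eP; rewrite card_ord in n_gt0.
  have [h [hyp le_h]] : exists h, hyp4 e h /\
      (300 * (h + 3) * (n + num_edges e) <= 4500 * maxn 1 (lambda * num_edges e))%N.
    have [n1|n1] := leqP n 1.
      have En : n = 1%N by lia.
      by have [hyp ->] := one_vertex e En; exists 0%N; split=> //; lia.
    (* Here [2 * lambda + 3 <= 5 * lambda] and [n + m <= 3 * m], whence 4500 as [300 * 5 * 3]. *)
    exists (2 * lambda)%N; split; first exact: tree_length_hyp4.
    have := vertices_le_edges eP adjP n1; have := tree_length_gt0 eP n1 tl.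
    by move=> l0 nm; apply: leq_trans (leq_mul (leqnn _) (leq_maxr _ _)); nia.
  have [t [x [p [out tb sp [xy yx]]]]] := mutual_path_output eP adjP hyp.
  exists t, (x :: p); split=> //; first exact: leq_trans tb le_h.
  have := mutual_path_ecc_tree_length eP tl sq (eq_leq qk) sp xy yx.
  by rewrite -(ler_nat R) natrD !natrM; lra.
(* 4500 is [900 * 5], since [h + 3] is at most five times the maximum of 1 and [delta]; 8 comes from
   [2 * h] with [h] at most [4 * (delta * ln n)]. *)
exists mutual_path_prog, 6, 4500, 8 => n e adj k delta eP adjP [q [sq qk]] hyp_d.
have [_ _ n_gt0 _] := eP; rewrite card_ord in n_gt0.
have d0 := hyperbolicity_ge0 eP hyp_d.
have [h [hyp le_h le_ln]] : exists h, [/\ hyp4 e h, h%:R <= 2 * delta &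
    h%:R <= 4 * (delta * ln (n%:R : R))].
  have [n1|n1] := leqP n 1.
    have En : n = 1%N by lia.
    have [hyp _] := one_vertex e En; exists 0%N; split=> //; first by rewrite mulr_ge0.
    by rewrite En ln1 mulr0 mulr0.
  exists (Num.truncn (2 * delta)); split; first exact: hyperbolicity_hyp4.
    by rewrite truncn_le mulr_ge0.
  have : (Num.truncn (2 * delta))%:R <= 2 * delta by rewrite truncn_le mulr_ge0.
  by have := ln_nat_ge_half R n1; nra.
have [t [x [p [out tb sp [xy yx]]]]] := mutual_path_output eP adjP hyp.
exists t, (x :: p); split=> //.
  have nm : (n + num_edges e <= 3 * maxn 1 (num_edges e))%N.
    have [n1|n1] := leqP n 1; first lia.
    by have := vertices_le_edges eP adjP n1; lia.
  have {tb} : (t <= 900 * (h + 3) * maxn 1 (num_edges e))%N by nia.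
  rewrite -(ler_nat R) !natrM natrD => /le_trans; apply.
  have M0 : 0 <= (maxn 1 (num_edges e))%:R :> R by [].
  rewrite mulrA; apply: ler_wpM2r => //.
  have : 1 <= Num.max 1 delta by rewrite le_max lexx.
  have : delta <= Num.max 1 delta by rewrite le_max lexx orbT.
  by lra.
have := mutual_path_ecc_hyp eP hyp sq (eq_leq qk) sp xy yx.
by rewrite -(ler_nat R) natrD natrM; lra.
Qed.
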